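(* Let $n,\ell$ be positive integers and $\bar T_1,\bar T_2$ 2-factor types. For $i=1,\ldots,\ell$, let $\mu_i$ be a positive integer and assume $HWP(\mu_iK_n;\bar T_1,\bar T_2;\alpha_i,\gamma_i)$ has a solution. Let $\mathcal{O}=\{i:\mu_i(n-1)\text{ is odd}\}$, let $\lambda$ be a positive integer, take any $(x_1,\ldots,x_\ell)\in\mathbb{N}^\ell$ with $\sum_{i=1}^\ell x_i\mu_i=\lambda$, and let $\beta=\sum_{i\in\mathcal{O}}x_i$. (i) If $\beta\le 1$, then $HWP(\lambda K_n;\bar T_1,\bar T_2;\sum_i x_i\alpha_i,\sum_i x_i\gamma_i)$ has a solution. (ii) If $\bar T_1$ is bipartite, then $HWP(\lambda K_n;\bar T_1,\bar T_2;\sum_i x_i\alpha_i+\bar\alpha,\sum_ix_i\gamma_i+\bar\gamma)$ has a solution for all nonnegative integers $\bar\alpha,\bar\gamma$ such that (a) $\bar\alpha+\bar\gamma=\lfloor\beta/2\rfloor$ and (b) $\bar\gamma=0$ if $\bar T_2$ is not bipartite.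
   Context: $\mu K_n$: complete multigraph on $n$ vertices with $\mu$ parallel edges per pair. A 2-factor has type $[c_1,\ldots,c_t]$ if it is a disjoint union of cycles of lengths $c_1,\ldots,c_t$ (2-cycles allowed in multigraphs); a type is bipartite if all lengths are even. A 2-factorization of an $r$-regular graph is a decomposition into $\lfloor r/2\rfloor$ 2-factors plus a single 1-factor if $r$ is odd. For an $r$-regular graph $\mathcal{G}$, 2-factor types $T_1,T_2$ and nonnegative integers $\alpha_1,\alpha_2$ with $\alpha_1+\alpha_2=\lfloor r/2\rfloor$, $HWP(\mathcal{G};T_1,T_2;\alpha_1,\alpha_2)$ (Hamilton–Waterloo Problem) asks whether $\mathcal{G}$ admits a 2-factorization with exactly $\alpha_1$ 2-factors of type $T_1$ and $\alpha_2$ of type $T_2$; it has a solution if such exists. *)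

(* Defs.v *)
From HB Require Import structures.
From mathcomp Require Import all_boot.

Set Implicit Arguments.
Unset Strict Implicit.
Unset Printing Implicit Defensive.

(* Loopless multigraphs on V, given by edge multiplicities: G (u, v) is the
   number of parallel edges joining u and v. *)
Definition is_multigraph (V : finType) (m : {ffun V * V -> nat}) : bool :=
  [forall u, forall v, m (u, v) == m (v, u)] && [forall u, m (u, u) == 0].

Record multigraph (V : finType) := Multigraph {
  mult :> {ffun V * V -> nat};
  multP : is_multigraph mult }.

HB.instance Definition _ (V : finType) := [isSub for @mult V].
HB.instance Definition _ (V : finType) := [Equality of multigraph V by <:].

Definition complete_mult (V : finType) (mu : nat) : {ffun V * V -> nat} :=
  [ffun e => if e.1 == e.2 then 0 else mu].

Lemma complete_multP (V : finType) (mu : nat) :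
  is_multigraph (complete_mult V mu).
Proof.
apply/andP; split; apply/forallP => u; last by rewrite ffunE /= eqxx.
by apply/forallP => v; rewrite !ffunE /= (eq_sym u v).
Qed.

Definition complete_multigraph (n mu : nat) : multigraph 'I_n :=
  Multigraph (complete_multP 'I_n mu).

Definition degree (V : finType) (G : multigraph V) (u : V) : nat :=
  \sum_(v : V) G (u, v).

Definition regular (V : finType) (r : nat) (G : multigraph V) : Prop :=
  forall u, degree G u = r.

(* All graphs share the vertex set V, so factors are automatically spanning,
   and partitioning the edges of G amounts to adding multiplicities. *)
Definition decomposes (V : finType) (G : multigraph V)
    (Fs : seq (multigraph V)) : Prop :=
  forall u v, G (u, v) = \sum_(F <- Fs) F (u, v).

(* Multiplicity of the edge uv in the cycle visiting the vertices of c in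
   order; a 2-cycle [:: u; v] gives uv multiplicity 2. *)
Definition cycle_mult (V : finType) (c : seq V) (u v : V) : nat :=
  count (fun x => ((x == u) && (next c x == v))
               || ((x == v) && (next c x == u))) c.

(* Types of 2-factors on n vertices; 2-cycles are allowed since mu K_n may have
   parallel edges. *)
Definition factor_type (n : nat) (T : seq nat) : bool :=
  all (leq 2) T && (sumn T == n).

Definition bipartite_type (T : seq nat) : bool := all (fun c => ~~ odd c) T.

(* F is the vertex-disjoint union of cycles whose lengths are, up to order,
   the entries of T. *)
Definition has_type (V : finType) (F : multigraph V) (T : seq nat) : Prop :=
  exists cs : seq (seq V),
    [/\ perm_eq (map size cs) T,
        all (fun c => 2 <= size c) cs,
        uniq (flatten cs),
        (forall v, v \in flatten cs) &
        forall u v, F (u, v) = \sum_(c <- cs) cycle_mult c u v].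

(* Fs lists the 2-factors; Is is empty for r even and consists of a single
   1-factor for r odd. *)
Definition two_factorization (V : finType) (r : nat) (G : multigraph V)
    (Fs Is : seq (multigraph V)) : Prop :=
  [/\ size Fs = r./2,
      size Is = odd r,
      {in Fs, forall F, regular 2 F},
      {in Is, forall I, regular 1 I} &
      decomposes G (Fs ++ Is)].

(* HWP(G; T1, T2; a1, a2) has a solution; a1 + a2 = r./2 is forced by the size
   of the 2-factorization. *)
Definition HWP (V : finType) (G : multigraph V) (T1 T2 : seq nat)
    (a1 a2 : nat) : Prop :=
  exists r, regular r G /\
  exists F1 F2 Is : seq (multigraph V),
    [/\ two_factorization r G (F1 ++ F2) Is,
        size F1 = a1, size F2 = a2,
        {in F1, forall F, has_type F T1} &
        {in F2, forall F, has_type F T2}].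

(* Main.v *)
(* Adding factorizations of mu_i K_n is harmless except that the odd ones each
   leave a 1-factor. Two leftover 1-factors I and J can be absorbed in one
   2-factor F of any bipartite type: choose F through I, so that F - I is again
   a 1-factor, and relabel the vertices in the factorization containing J so
   that J becomes F - I; this is allowed because complete multigraphs are
   invariant under relabelling and all 1-factors on V are isomorphic. *)

Require Import Defs.
From mathcomp Require Import all_boot zify.

Set Implicit Arguments.
Unset Strict Implicit.
Unset Printing Implicit Defensive.

Section Multigraphs.

Variable V : finType.
Implicit Types (G F I J : multigraph V) (c s : seq V) (u v w : V).

(** * Degrees, relabelling and subtraction of multigraphs *)

Lemma mult_sym G u v : G (u, v) = G (v, u).
Proof. by have /andP[/forallP/(_ u)/forallP/(_ v)/eqP] := multP G. Qed.

Lemma mult_irr G u : G (u, u) = 0.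
Proof. by have /andP[_ /forallP/(_ u)/eqP] := multP G. Qed.

(** Termwise inequality between two sums with equal totals forces equality in every term. This
    reduces equality of 1-factors to inclusion of edges. *)
Lemma leq_mult_eq G F :
  (forall u v, G (u, v) <= F (u, v)) -> (forall u, degree G u = degree F u) ->
  forall u v, G (u, v) = F (u, v).
Proof.
move=> leGF degGF u v; apply/eqP; move: (degGF u) => /eqP.
rewrite /degree (leqif_sum (fun w _ => leqif_eq (leGF u w))).
by move/forallP/(_ v).
Qed.

Lemma degree_decomposes G (Fs : seq (multigraph V)) u :
  decomposes G Fs -> degree G u = \sum_(F <- Fs) degree F u.
Proof.
by move=> dec; rewrite exchange_big; apply: eq_bigr => v _; apply: dec.
Qed.

Lemma degree_sum_regular r (Fs : seq (multigraph V)) u :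
  {in Fs, forall F, regular r F} -> \sum_(F <- Fs) degree F u = size Fs * r.
Proof.
move=> reg; rewrite big_seq (eq_bigr (fun=> r)) => [|F /reg/(_ u)//].
by rewrite -big_seq big_const_seq count_predT iter_addn_0 mulnC.
Qed.

Lemma degree_complete m u :
  degree (Multigraph (complete_multP V m)) u = m * (#|V| - 1).
Proof.
rewrite /degree (bigD1 u) //= ffunE /= eqxx add0n.
rewrite (eq_bigr (fun=> m)) => [|v neq_vu]; last first.
  by rewrite ffunE /= eq_sym (negbTE neq_vu).
by rewrite sum_nat_const mulnC subn1 -(cardC1 u).
Qed.

(** The pullback of [G] along [p]; bijectivity of [p] is assumed only in the lemmas that use it. *)
Definition relabel_mult (p : V -> V) G : {ffun V * V -> nat} :=
  [ffun e => G (p e.1, p e.2)].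

Lemma relabel_multP p G : is_multigraph (relabel_mult p G).
Proof.
apply/andP; split; apply/forallP => u; last by rewrite ffunE mult_irr.
by apply/forallP => v; rewrite !ffunE mult_sym.
Qed.

Definition relabel p G := Multigraph (relabel_multP p G).

(** Subtraction is truncated, so this removes the edges of [F] from [G] only when [F] is contained
    in [G]. *)
Definition sub_mult G F : {ffun V * V -> nat} := [ffun e => G e - F e].

Lemma sub_multP G F : is_multigraph (sub_mult G F).
Proof.
apply/andP; split; apply/forallP => u; last by rewrite ffunE mult_irr.
by apply/forallP => v; rewrite !ffunE mult_sym (mult_sym F).
Qed.

Definition sub_multigraph G F := Multigraph (sub_multP G F).

Lemma degree_sub G F u : (forall v, F (u, v) <= G (u, v)) ->
  degree (sub_multigraph G F) u = degree G u - degree F u.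
Proof.
move=> leFG; rewrite /degree -sumnB => [|v _]; last exact: leFG.
by apply: eq_bigr => v _; rewrite ffunE.
Qed.

(** * Cycles as multigraphs, and 2-factors of a given type *)

Lemma next_neq c u : uniq c -> 1 < size c -> u \in c -> next c u != u.
Proof.
move=> Uc sz_c uc; have [i c' def_c] := rot_to uc.
rewrite -(next_rot i Uc) def_c; move: Uc sz_c.
rewrite -(rot_uniq i) -(size_rot i) def_c.
case: c' {def_c} => //= v c'; rewrite eqxx inE eq_sym => /andP[].
by case: eqP.
Qed.

Lemma cycle_multC c u v : cycle_mult c u v = cycle_mult c v u.
Proof. by apply: eq_count => w; rewrite orbC. Qed.

(** The edges of [c] at [u] lead to its successor and its predecessor; in a 2-cycle these coincide,
    and the sum gives multiplicity 2. *)
Lemma cycle_multE c u v : uniq c -> 1 < size c ->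
  cycle_mult c u v = (u \in c) * ((next c u == v) + (prev c u == v)).
Proof.
move=> Uc sz_c; rewrite /cycle_mult.
pose a x := (x == u) && (next c x == v).
pose b x := (x == v) && (next c x == u).
have cntE w z : count (fun x => (x == w) && (next c x == z)) c
                = (w \in c) * (next c w == z).
  rewrite -(count_uniq_mem _ Uc).
  case: (boolP (next c w == z)) => nwz.
    by rewrite muln1; apply: eq_count => x /=; case: eqP => // ->.
  rewrite muln0 (eq_count (a2 := pred0)) ?count_pred0 // => x /=.
  by case: eqP => // ->; apply: negbTE.
(* No edge is counted in both directions at once: that would make some vertex its own successor. *)
have ab0 : count (predI a b) c = 0.
  apply/eqP; rewrite -leqn0 leqNgt -has_count; apply/hasPn => x xc /=.
  apply/negP => /andP[/andP[_ /eqP nx] /andP[/eqP xv _]].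
  by move: (next_neq Uc sz_c xc); rewrite nx xv eqxx.
have := count_predUI a b c; rewrite ab0 addn0 => ->.
rewrite !cntE mulnDr; congr (_ + _).
case: (boolP (u \in c)) => uc.
  rewrite mul1n; case: (eqVneq (prev c u) v) => [<-|neq].
    by rewrite mem_prev uc next_prev // eqxx.
  case: (boolP (v \in c)) => vc //; rewrite mul1n; apply/eqP; rewrite eqb0.
  by apply: contraNneq neq => <-; rewrite prev_next.
case: (boolP (v \in c)) => vc //; rewrite mul1n mul0n; apply/eqP; rewrite eqb0.
by apply: contraNneq uc => <-; rewrite mem_next.
Qed.

Lemma sum_cycle_mult c u : uniq c -> 1 < size c ->
  \sum_v cycle_mult c u v = (u \in c) * 2.
Proof.
move=> Uc sz_c; under eq_bigr => v _ do rewrite cycle_multE //.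
rewrite -big_distrr /= big_split /=.
have sum1 w : \sum_v (w == v :> V) = 1.
  rewrite (bigD1 w) //= eqxx big1 // => v.
  by rewrite eq_sym => /negbTE->.
by rewrite !sum1.
Qed.

(** Before the last position there is no wrap-around, so [next] is the following entry. *)
Lemma cycle_mult_nth x0 c i : uniq c -> i.+1 < size c ->
  0 < cycle_mult c (nth x0 c i) (nth x0 c i.+1).
Proof.
move=> Uc lt_i; rewrite -has_count; apply/hasP.
have ic : nth x0 c i \in c by rewrite mem_nth // ltnW.
exists (nth x0 c i) => //; rewrite eqxx next_nth ic index_uniq // 1?ltnW //.
case: c Uc lt_i {ic} => //= y c _ lt_i.
by rewrite (set_nth_default x0 y) ?eqxx.
Qed.

(** Each vertex lies on exactly one cycle, and that cycle contributes 2 to its degree. *)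
Lemma has_type_regular F T : has_type F T -> regular 2 F.
Proof.
move=> [cs [_ sz_cs Ucs covcs defF]] u; rewrite /degree.
under eq_bigr => v _ do rewrite defF.
rewrite exchange_big /=.
have uniq_cs c : c \in cs -> uniq c.
  move=> /rot_to[i cs' def_cs]; move: Ucs.
  have /perm_flatten/perm_uniq <- : perm_eq (rot i cs) cs by rewrite perm_rot.
  by rewrite def_cs /= cat_uniq => /and3P[].
rewrite big_seq (eq_bigr (fun c : seq V => (u \in c) * 2)) => [|c c_cs].
  rewrite -big_seq -big_distrl /=.
  suff -> : \sum_(c <- cs) (u \in c) = 1 by [].
  have <- : count_mem u (flatten cs) = 1 by rewrite count_uniq_mem // covcs.
  rewrite count_flatten sumnE big_map big_seq [RHS]big_seq; apply: eq_bigr => c c_cs.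
  by rewrite count_uniq_mem ?uniq_cs.
by rewrite sum_cycle_mult ?uniq_cs //; apply: (allP sz_cs).
Qed.

Definition cycles_mult (cs : seq (seq V)) : {ffun V * V -> nat} :=
  [ffun e => \sum_(c <- cs) cycle_mult c e.1 e.2].

Lemma cycles_multP cs : all (fun c : seq V => 2 <= size c) cs ->
  all uniq cs -> is_multigraph (cycles_mult cs).
Proof.
move=> sz_cs Ucs; apply/andP; split; apply/forallP => u.
  apply/forallP => v; rewrite !ffunE /=; apply/eqP.
  by apply: eq_bigr => c _; apply: cycle_multC.
rewrite ffunE /= big_seq big1 // => c c_cs.
have [Uc sz_c] := (allP Ucs c c_cs, allP sz_cs c c_cs).
rewrite cycle_multE //; case: (boolP (u \in c)) => // uc.
rewrite (negbTE (next_neq Uc sz_c uc)) add0n mul1n; apply/eqP; rewrite eqb0.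
(* A vertex that is its own predecessor would also be its own successor. *)
apply: contraNneq (next_neq Uc sz_c uc) => {1}<-.
by rewrite next_prev.
Qed.

Lemma cycle_mult_map (p q : V -> V) c u v : cancel p q -> cancel q p ->
  uniq c -> cycle_mult (map q c) u v = cycle_mult c (p u) (p v).
Proof.
move=> pK qK Uc; rewrite /cycle_mult count_map; apply: eq_count => x /=.
by rewrite (next_map (can_inj qK)) // !(can2_eq qK pK).
Qed.

Lemma flatten_all_uniq (cs : seq (seq V)) : uniq (flatten cs) -> all uniq cs.
Proof. by elim: cs => //= c cs IH; rewrite cat_uniq => /and3P[-> _ /IH]. Qed.

(** Since [relabel p] pulls back along [p], its cycles are the images of the old ones under the
    inverse [q]. *)
Lemma has_type_relabel (p q : V -> V) F T : cancel p q -> cancel q p ->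
  has_type F T -> has_type (relabel p F) T.
Proof.
move=> pK qK [cs [szT sz_cs Ucs covcs defF]]; exists (map (map q) cs); split.
- rewrite -map_comp (eq_map (g := size)) // => c; exact: size_map.
- by rewrite all_map; apply: sub_all sz_cs => c; rewrite /= size_map.
- by rewrite -map_flatten (map_inj_uniq (can_inj qK)).
- by move=> v; rewrite -map_flatten -(pK v) (mem_map (can_inj qK)).
move=> u v; rewrite ffunE defF /= big_map big_seq [RHS]big_seq.
apply: eq_bigr => c c_cs; rewrite (cycle_mult_map _ _ pK qK) //.
exact: (allP (flatten_all_uniq Ucs)).
Qed.

Lemma regular_relabel (p q : V -> V) r G : cancel p q -> cancel q p ->
  regular r G -> regular r (relabel p G).
Proof.
move=> pK qK regG u; rewrite -(regG (p u)) /degree.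
rewrite [RHS](reindex p); last by exists q => v _.
by apply: eq_bigr => v _; rewrite ffunE.
Qed.

(** * 1-factors: enumeration along edges, isomorphism, extension to 2-factors *)

(** Cutting [s] into consecutive blocks of two yields edges of [I]. *)
Definition pairs_up x0 I s :=
  forall k, k.*2.+1 < size s -> I (nth x0 s k.*2, nth x0 s k.*2.+1) = 1.

Lemma one_factor_leq1 I u v : regular 1 I -> I (u, v) <= 1.
Proof. by move=> /(_ u) <-; rewrite /degree (bigD1 v) //= leq_addr. Qed.

Lemma one_factor_mate I u : regular 1 I -> exists v, I (u, v) = 1.
Proof.
move=> reg1; have [v Iuv|I0] := pickP (fun v => 0 < I (u, v)).
  by exists v; apply/eqP; rewrite eqn_leq Iuv one_factor_leq1.
move: (reg1 u); rewrite /degree big1 // => v _.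
by apply/eqP; rewrite -leqn0 leqNgt I0.
Qed.

Lemma one_factor_mate_uniq I u v w : regular 1 I ->
  0 < I (u, v) -> 0 < I (u, w) -> v = w.
Proof.
move=> /(_ u) deg1 Iuv Iuw; case: (eqVneq v w) => // neq.
by move: deg1; rewrite /degree (bigD1 v) //= (bigD1 w) 1?eq_sym //=; lia.
Qed.

(** The list grows greedily: an unlisted vertex is prepended together with its mate. Closure of the
    list under mates guarantees that the mate is also new. *)
Lemma one_factor_enum x0 I : regular 1 I ->
  exists s, [/\ uniq s, forall v, v \in s, ~~ odd (size s) & pairs_up x0 I s].
Proof.
move=> reg1.
suff ext k s : #|V| - size s <= k -> uniq s -> ~~ odd (size s) ->
    pairs_up x0 I s -> (forall u v, 0 < I (u, v) -> u \in s -> v \in s) ->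
    exists s, [/\ uniq s, forall v, v \in s, ~~ odd (size s) & pairs_up x0 I s].
  by apply: (ext #|V| [::]) => //; rewrite subn0.
elim: k s => [|k IH] s le_k Us ev_s pr_s cl_s;
    have [v vs|sT] := pickP (fun v => v \notin s);
    try by exists s; split=> // v; apply/negbFE/sT.
  (* With no vertices left to list, a further [v] would give more than [#|V|] distinct vertices. *)
  have /card_uniqP card_vs : uniq (v :: s) by rewrite /= vs.
  have := max_card (mem (v :: s)); rewrite card_vs => /leq_trans le_s.
  by move: le_k; rewrite leqn0 subn_eq0 => /le_s; rewrite ltnn.
have [w Ivw] := one_factor_mate v reg1.
have ws : w \notin s.
  by apply: contra vs => /(cl_s w v); apply; rewrite mult_sym Ivw.
have neq_vw : v != w.
  by apply: contra_eq_neq Ivw => ->; rewrite mult_irr.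
apply: (IH [:: v, w & s]) => //=.
- by move: le_k; rewrite !leq_subLR => /leq_trans-> //; lia.
- by rewrite inE negb_or neq_vw vs ws.
- by rewrite negbK.
- by case=> [|j] //= lt_j; apply: pr_s; move: lt_j; rewrite doubleS; lia.
move=> a b Iab; rewrite !inE => /or3P[/eqP eq_a|/eqP eq_a|as_].
- rewrite eq_a in Iab.
  by rewrite (one_factor_mate_uniq reg1 Iab (w := w)) ?Ivw ?eqxx ?orbT.
- rewrite eq_a in Iab.
  by rewrite (one_factor_mate_uniq reg1 Iab (w := v)) ?eqxx // mult_sym Ivw.
by rewrite (cl_s a b) ?orbT.
Qed.

(** Mates are unique, so the parity of the index of [u] tells whether its mate is the next or the
    previous entry; even length ensures that an even position has a next one. *)
Lemma pairs_up_mate x0 I s u v : regular 1 I -> ~~ odd (size s) ->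
  pairs_up x0 I s -> u \in s -> 0 < I (u, v) ->
  exists2 k, k.*2.+1 < size s &
    (u, v) = (nth x0 s k.*2, nth x0 s k.*2.+1) \/
    (v, u) = (nth x0 s k.*2, nth x0 s k.*2.+1).
Proof.
move=> reg1 ev_s pr_s us Iuv; have lt_i := us; rewrite -index_mem in lt_i.
have def_u := nth_index x0 us; set i := index u s in lt_i def_u.
have := odd_double_half i; case: (boolP (odd i)) => odd_i /=.
  rewrite add1n => def_i; exists i./2; rewrite def_i //; right.
  have lt_k : i./2.*2.+1 < size s by rewrite def_i.
  have := pr_s _ lt_k; rewrite def_i def_u mult_sym => Iu.
  by rewrite (one_factor_mate_uniq reg1 Iuv (w := nth x0 s i./2.*2)) ?Iu.
rewrite add0n => def_i; have lt_k : i./2.*2.+1 < size s.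
  rewrite def_i ltn_neqAle lt_i andbT.
  by apply: contraNneq ev_s => <-; rewrite /= odd_i.
exists i./2 => //; left; have := pr_s _ lt_k; rewrite def_i def_u => Iu.
by rewrite (one_factor_mate_uniq reg1 Iuv (w := nth x0 s i.+1)) ?Iu.
Qed.

(** Both 1-factors are enumerated edge by edge, and [p] sends the i-th vertex of one list to the
    i-th of the other. *)
Lemma one_factors_isomorphic (x0 : V) I J : regular 1 I -> regular 1 J ->
  exists p q : V -> V, [/\ cancel p q, cancel q p &
    forall u v, J (p u, p v) = I (u, v)].
Proof.
move=> regI regJ.
have [s [Us sT ev_s pr_s]] := one_factor_enum x0 regI.
have [t [Ut tT ev_t pr_t]] := one_factor_enum x0 regJ.
have eq_sz : size s = size t.
  by apply/perm_size/uniq_perm => // v; rewrite sT tT.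
have transfer_can (a b : seq V) : (forall v, v \in a) -> uniq b ->
    size a = size b ->
    cancel (fun v => nth x0 b (index v a)) (fun v => nth x0 a (index v b)).
  by move=> aT Ub eq_ab v; rewrite index_uniq ?nth_index // -eq_ab index_mem.
pose p v := nth x0 t (index v s); pose q v := nth x0 s (index v t).
have [pK qK] : cancel p q /\ cancel q p by split; apply: transfer_can.
exists p, q; split=> // u v.
suff /(_ u v) -> : forall u v, I (u, v) = relabel p J (u, v).
  by rewrite ffunE.
(* Both sides are 1-regular, so it suffices that [p] sends edges of [I] to edges of [J]. *)
apply: leq_mult_eq => [{}u {}v|{}u]; last first.
  by rewrite regI (regular_relabel pK qK regJ).
case: (posnP (I (u, v))) => [-> //|Iuv].
apply: leq_trans (one_factor_leq1 u v regI) _; rewrite ffunE /=.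
have pE i : i < size s -> p (nth x0 s i) = nth x0 t i.
  by move=> lt_i; rewrite /p index_uniq.
have [k lt_k uv] := pairs_up_mate regI ev_s pr_s (sT u) Iuv.
have Jk : J (p (nth x0 s k.*2), p (nth x0 s k.*2.+1)) = 1.
  by rewrite !pE ?(ltnW lt_k) // pr_t -?eq_sz.
by case: uv => [[-> ->]|[-> ->]]; last rewrite mult_sym; rewrite Jk.
Qed.

Lemma pairs_up_cat x0 I s t : ~~ odd (size s) -> pairs_up x0 I (s ++ t) ->
  pairs_up x0 I s /\ pairs_up x0 I t.
Proof.
move=> ev_s pr_st; split=> k lt_k.
  have := pr_st k; rewrite size_cat !nth_cat lt_k (ltnW lt_k) => -> //.
  by rewrite ltn_addr.
have := pr_st (uphalf (size s) + k).
(* As [size s] is even, pair [k] of [t] is pair [size s / 2 + k] of the concatenation. *)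
have -> : (uphalf (size s) + k).*2 = size s + k.*2 by lia.
have nth_t j : nth x0 (s ++ t) (size s + j) = nth x0 t j.
  by rewrite nth_cat ltnNge leq_addr addKn.
by rewrite size_cat -addnS !nth_t ltn_add2l; apply.
Qed.

Lemma pairs_up_flatten x0 I (cs : seq (seq V)) :
  all (fun c => ~~ odd (size c)) cs -> pairs_up x0 I (flatten cs) ->
  forall c, c \in cs -> pairs_up x0 I c.
Proof.
elim: cs => //= d cs IH /andP[ev_d ev_cs] /(pairs_up_cat ev_d)[pr_d pr_cs] c.
by rewrite inE => /predU1P[-> //|]; apply: IH.
Qed.

(* Listing the vertices so that I joins s_0 s_1, s_2 s_3, ... and cutting the
   list into blocks of even lengths T gives cycles passing through all of I. *)
Lemma one_factor_extend (x0 : V) I T : regular 1 I -> bipartite_type T ->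
  factor_type #|V| T ->
  exists2 F, has_type F T & forall u v, I (u, v) <= F (u, v).
Proof.
move=> regI bipT /andP[T_ge2 /eqP sumT].
have [s [Us sT ev_s pr_s]] := one_factor_enum x0 regI.
have sz_s : size s = sumn T.
  rewrite sumT cardE; apply/perm_size/uniq_perm => //; first exact: enum_uniq.
  by move=> v; rewrite sT mem_enum.
have flatE : flatten (reshape T s) = s by rewrite reshapeKr ?sz_s.
have shE : map size (reshape T s) = T.
  by rewrite -/(shape _) reshapeKl ?sz_s.
have sz_cs : all (fun c : seq V => 1 < size c) (reshape T s).
  by have := T_ge2; rewrite -{1}shE all_map.
have ev_cs : all (fun c : seq V => ~~ odd (size c)) (reshape T s).
  by have := bipT; rewrite /bipartite_type -{1}shE all_map.
have Ucs : all uniq (reshape T s) by rewrite flatten_all_uniq ?flatE.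
exists (Multigraph (cycles_multP sz_cs Ucs)).
  exists (reshape T s); rewrite ?flatE ?shE; split=> // u v.
  by rewrite ffunE.
move=> u v; case: (posnP (I (u, v))) => [-> //|Iuv].
apply: leq_trans (one_factor_leq1 u v regI) _; rewrite ffunE /=.
have /flattenP[c c_cs uc] : u \in flatten (reshape T s) by rewrite flatE.
have pr_c : pairs_up x0 I c.
  by apply: (pairs_up_flatten ev_cs) c_cs; rewrite flatE.
rewrite (big_rem c) //= ltn_addr //.
have Uc := allP Ucs c c_cs.
have [k lt_k [[-> ->]|[-> ->]]] :=
  pairs_up_mate regI (allP ev_cs c c_cs) pr_c uc Iuv.
  exact: cycle_mult_nth.
by rewrite cycle_multC cycle_mult_nth.
Qed.

(** * Factorizations of complete multigraphs with any number of 1-factors *)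

(* Unlike in HWP, the number b of 1-factors is arbitrary. *)
Definition factorization m (T1 T2 : seq nat) a1 a2 b : Prop :=
  exists F1 F2 Is : seq (multigraph V),
    [/\ size F1 = a1, size F2 = a2 & size Is = b] /\
    [/\ {in F1, forall F, has_type F T1}, {in F2, forall F, has_type F T2},
        {in Is, forall I, regular 1 I} &
        decomposes (Multigraph (complete_multP V m)) (F1 ++ F2 ++ Is)].

Lemma factorization0 T1 T2 : factorization 0 T1 T2 0 0 0.
Proof.
exists [::], [::], [::]; split; split=> // u v.
by rewrite big_nil ffunE; case: eqP.
Qed.

(** This symmetry lets merging, stated for a new 2-factor of type [T1], also produce one of type
    [T2]. *)
Lemma factorizationC m T1 T2 a1 a2 b :
  factorization m T1 T2 a1 a2 b -> factorization m T2 T1 a2 a1 b.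
Proof.
move=> [F1 [F2 [Is [[? ? ?] [? ? ? dec]]]]]; exists F2, F1, Is.
by split; split=> // u v; rewrite dec !big_cat /= addnCA.
Qed.

(** Only the total multiplicities of [Hs] matter, so its members may regroup the edges of [Fs] and
    [Gs], as merging does. *)
Lemma decomposes_complete_add m1 m2 (Fs Gs Hs : seq (multigraph V)) :
  decomposes (Multigraph (complete_multP V m1)) Fs ->
  decomposes (Multigraph (complete_multP V m2)) Gs ->
  (forall u v, \sum_(F <- Hs) F (u, v) =
     \sum_(F <- Fs) F (u, v) + \sum_(F <- Gs) F (u, v)) ->
  decomposes (Multigraph (complete_multP V (m1 + m2))) Hs.
Proof.
move=> dec1 dec2 decH u v; rewrite decH -dec1 -dec2 !ffunE /=.
by case: eqP.
Qed.

Lemma in_catP (T : eqType) (s t : seq T) (P : T -> Prop) :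
  {in s, forall z, P z} -> {in t, forall z, P z} -> {in s ++ t, forall z, P z}.
Proof. by move=> Ps Pt z; rewrite mem_cat => /orP[/Ps|/Pt]. Qed.

Lemma factorization_add m m' T1 T2 a1 a2 b a1' a2' b' :
  factorization m T1 T2 a1 a2 b -> factorization m' T1 T2 a1' a2' b' ->
  factorization (m + m') T1 T2 (a1 + a1') (a2 + a2') (b + b').
Proof.
move=> [F1 [F2 [Is [[sz1 sz2 sz3] [ty1 ty2 re dec]]]]].
move=> [G1 [G2 [Js [[sz1' sz2' sz3'] [ty1' ty2' re' dec']]]]].
exists (F1 ++ G1), (F2 ++ G2), (Is ++ Js); split.
  by rewrite !size_cat; split; congr (_ + _).
split; try exact: in_catP.
apply: (decomposes_complete_add dec dec') => u v.
by rewrite !big_cat /=; lia.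
Qed.

Lemma decomposes_relabel (p q : V -> V) m
    (Fs : seq (multigraph V)) : cancel p q -> cancel q p ->
  decomposes (Multigraph (complete_multP V m)) Fs ->
  decomposes (Multigraph (complete_multP V m)) (map (relabel p) Fs).
Proof.
move=> pK qK dec u v; rewrite big_map.
under eq_bigr => F _ do rewrite ffunE /=.
by rewrite -dec !ffunE /= (can_eq pK).
Qed.

(* Relabelling the second factorization turns its 1-factor into the complement
   of the first one's 1-factor in a 2-factor of type T1. *)
Lemma factorization_merge m m' T1 T2 a1 a2 b a1' a2' b' :
  bipartite_type T1 -> factor_type #|V| T1 -> 0 < #|V| ->
  factorization m T1 T2 a1 a2 b.+1 -> factorization m' T1 T2 a1' a2' b'.+1 ->
  factorization (m + m') T1 T2 (a1 + a1').+1 (a2 + a2') (b + b').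
Proof.
move=> bipT facT /card_gt0P[x0 _].
move=> [F1 [F2 [[|I Is] [[sz1 sz2 //= [sz3]] [ty1 ty2 re dec]]]]].
move=> [G1 [G2 [[|J Js] [[sz1' sz2' //= [sz3']] [ty1' ty2' re' dec']]]]].
have regI : regular 1 I by apply: re; rewrite inE eqxx.
have regJ : regular 1 J by apply: re'; rewrite inE eqxx.
have [F tyF leIF] := one_factor_extend x0 regI bipT facT.
have regFI : regular 1 (sub_multigraph F I).
  by move=> u; rewrite degree_sub // (has_type_regular tyF) regI.
have [p [q [pK qK pJ]]] := one_factors_isomorphic x0 regFI regJ.
have {}dec' := decomposes_relabel pK qK dec'.
exists (F :: F1 ++ map (relabel p) G1), (F2 ++ map (relabel p) G2),
  (Is ++ map (relabel p) Js); split.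
  by rewrite /= !size_cat !size_map; split; congruence.
split.
- apply: (@in_catP _ [:: F]) => [G|]; first by rewrite inE => /eqP->.
  apply: in_catP => // _ /mapP[G /ty1' tyG ->]; exact: has_type_relabel tyG.
- apply: in_catP => // _ /mapP[G /ty2' tyG ->]; exact: has_type_relabel tyG.
- apply: in_catP => [G Gs|_ /mapP[G Gs ->]].
    by apply: re; rewrite inE Gs orbT.
  by apply: (regular_relabel pK qK); apply: re'; rewrite inE Gs orbT.
apply: (decomposes_complete_add dec dec') => u v.
rewrite !map_cat /= !big_cons !big_cat /= !big_cons.
have -> : relabel p J (u, v) = F (u, v) - I (u, v) by rewrite ffunE pJ ffunE.
(* The truncated difference is exact because [I] is contained in [F], so [I] and the relabelled [J]
   add up to [F]. *)
have := leIF u v; move: (F _) (I _) => f i; lia.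
Qed.

(** Counting degrees gives [m * (#|V| - 1) = 2 * (a1 + a2) + b]; with [b <= 1], halving this yields
    the number of 2-factors and its parity is [b]. *)
Lemma factorization_HWP m T1 T2 a1 a2 b : 0 < #|V| -> b <= 1 ->
  factorization m T1 T2 a1 a2 b ->
  HWP (Multigraph (complete_multP V m)) T1 T2 a1 a2.
Proof.
move=> /card_gt0P[x0 _] le_b1 [F1 [F2 [Is [[sz1 sz2 sz3] [ty1 ty2 re dec]]]]].
have re2 : {in F1 ++ F2, forall F, regular 2 F}.
  by apply: in_catP => F => [/ty1|/ty2]; apply: has_type_regular.
exists (m * (#|V| - 1)); split; first exact: degree_complete.
have := degree_decomposes x0 dec; rewrite degree_complete catA big_cat /=.
rewrite (degree_sum_regular _ re2) (degree_sum_regular _ re) => ->.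
exists F1, F2, Is; split=> //; split=> //; last by rewrite -catA.
  by rewrite muln1 muln2 addnC halfD odd_double andbF doubleK; lia.
by rewrite muln1 muln2 oddD odd_double; lia.
Qed.

(** The degree at any vertex determines [r], whose parity is the number of 1-factors. *)
Lemma HWP_factorization m T1 T2 a1 a2 : 0 < #|V| ->
  HWP (Multigraph (complete_multP V m)) T1 T2 a1 a2 ->
  factorization m T1 T2 a1 a2 (odd (m * (#|V| - 1))).
Proof.
move=> /card_gt0P[x0 _] [r [/(_ x0)]]; rewrite degree_complete => ->.
move=> [F1 [F2 [Is [[_ szI _ reI dec] sz1 sz2 ty1 ty2]]]].
by exists F1, F2, Is; split=> //; split=> //; rewrite catA.
Qed.

(** * Combining a list of factorizations *)

(** Induction on [s], keeping at most one pending 1-factor: an odd member either leaves its own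
    1-factor pending or merges it with the one already pending. *)
Lemma factorization_merge_seq (L : eqType) (mu a1 a2 : L -> nat)
    (odd_mu : L -> bool) T1 T2 (s : seq L) :
  0 < #|V| -> factor_type #|V| T1 -> factor_type #|V| T2 ->
  (forall i, factorization (mu i) T1 T2 (a1 i) (a2 i) (odd_mu i)) ->
  bipartite_type T1 -> forall abar gbar,
  abar + gbar = (\sum_(i <- s) odd_mu i)./2 ->
  (~~ bipartite_type T2 -> gbar = 0) ->
  factorization (\sum_(i <- s) mu i) T1 T2 (\sum_(i <- s) a1 i + abar)
    (\sum_(i <- s) a2 i + gbar) (odd (\sum_(i <- s) odd_mu i)).
Proof.
move=> V_gt0 fac1 fac2 sol bip1; elim: s => [|i s IH] abar gbar.
  rewrite !big_nil => /eqP; rewrite addn_eq0 => /andP[/eqP-> /eqP->] _.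
  exact: factorization0.
rewrite !big_cons -!addnA; move: IH (sol i).
set beta := \sum_(j <- s) _; case: (odd_mu i) => IH fac_i; last first.
  by rewrite add0n => eq_b bip2; apply: (factorization_add fac_i (IH _ _ _ _)).
rewrite add1n /= uphalf_half; case: (boolP (odd beta)) IH => odd_b IH.
  rewrite /= add1n => eq_b bip2.
  (* The merged 2-factor is charged to [abar] while that is positive, and otherwise to [gbar], which
     is then positive, so [T2] is bipartite. *)
  case: abar eq_b => [|abar] eq_b; last first.
    rewrite !addnS; apply: (factorization_merge _ _ _ fac_i (IH _ _ _ _)) => //.
    by lia.
  case: gbar eq_b bip2 => [//|gbar] eq_b bip2.
  have {}bip2 : bipartite_type T2 by case: bipartite_type bip2 => // /(_ isT).
  rewrite !addnS; apply: factorizationC.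
  apply: (factorization_merge _ _ _ (factorizationC fac_i)
    (factorizationC (IH _ _ _ _))) => //; first by lia.
  by rewrite bip2.
rewrite /= add0n => eq_b bip2.
exact: (factorization_add fac_i (IH _ _ eq_b bip2)).
Qed.

(** No merging takes place, so all 1-factors survive; this serves the case where at most one occurs
    in total. *)
Lemma factorization_add_seq (L : eqType) (mu a1 a2 b : L -> nat) T1 T2
    (s : seq L) :
  (forall i, factorization (mu i) T1 T2 (a1 i) (a2 i) (b i)) ->
  factorization (\sum_(i <- s) mu i) T1 T2 (\sum_(i <- s) a1 i)
    (\sum_(i <- s) a2 i) (\sum_(i <- s) b i).
Proof.
move=> sol; elim: s => [|i s IH]; first by rewrite !big_nil; apply: factorization0.
by rewrite !big_cons; apply: factorization_add.
Qed.

End Multigraphs.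

(** Listing each index [i] with [x i] repetitions turns weighted sums into plain sums over a list,
    on which induction can run. *)
Lemma sum_copies (L : finType) (x f : L -> nat) :
  \sum_(j <- flatten [seq nseq (x i) i | i <- enum L]) f j =
  \sum_i x i * f i.
Proof.
rewrite big_flatten big_map big_enum; apply: eq_bigr => i _.
by rewrite big_nseq iter_addn_0 mulnC.
Qed.

Theorem theorem7p1 (n l : nat) (n_gt0 : 0 < n) (l_gt0 : 0 < l)
    (T1 T2 : seq nat) (T1_type : factor_type n T1) (T2_type : factor_type n T2)
    (mu alpha gamma : 'I_l -> nat)
    (mu_gt0 : forall i, 0 < mu i)
    (sol : forall i,
       HWP (complete_multigraph n (mu i)) T1 T2 (alpha i) (gamma i))
    (lambda : nat) (lambda_gt0 : 0 < lambda)
    (x : 'I_l -> nat) (sum_x : \sum_(i < l) x i * mu i = lambda) :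
  let O := [set i : 'I_l | odd (mu i * (n - 1))] in
  let beta := \sum_(i in O) x i in
  (beta <= 1 ->
     HWP (complete_multigraph n lambda) T1 T2
       (\sum_(i < l) x i * alpha i) (\sum_(i < l) x i * gamma i))
  /\
  (bipartite_type T1 ->
     forall abar gbar : nat,
       abar + gbar = beta./2 ->
       (~~ bipartite_type T2 -> gbar = 0) ->
       HWP (complete_multigraph n lambda) T1 T2
         (\sum_(i < l) x i * alpha i + abar)
         (\sum_(i < l) x i * gamma i + gbar)).
Proof.
move=> O beta.
have V_gt0 : 0 < #|'I_n| by rewrite card_ord.
pose s := flatten [seq nseq (x i) i | i <- enum 'I_l].
pose odd_mu i := odd (mu i * (n - 1)).
have sumE (f : 'I_l -> nat) : \sum_(i < l) x i * f i = \sum_(j <- s) f j.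
  by rewrite sum_copies.
have betaE : beta = \sum_(j <- s) odd_mu j.
  rewrite -sumE /beta big_mkcond; apply: eq_bigr => i _.
  by rewrite inE /odd_mu; case: odd; rewrite ?muln1 ?muln0.
have fac i :
    factorization 'I_n (mu i) T1 T2 (alpha i) (gamma i) (odd_mu i).
  by have := HWP_factorization V_gt0 (sol i); rewrite card_ord.
rewrite -sum_x !sumE betaE; split=> [le_b|bip1 abar gbar eq_b bip2].
  exact: (factorization_HWP V_gt0 le_b (factorization_add_seq s fac)).
(* After merging, the number of remaining 1-factors is the parity of [beta], hence at most one. *)
apply: (factorization_HWP V_gt0 (leq_b1 _)).
by apply: (factorization_merge_seq _ _ _ fac bip1 eq_b bip2); rewrite ?card_ord.
Qed.
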